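(* Let $p_1,\dots,p_n\in\mathbb{R}^d$, let $W\in\mathbb{R}^{n\times n}$ with $W_{ij}=p_i^\top p_j$, let $k$ be a positive integer, and let $b(1),\dots,b(\ell)$ be a sequence of consecutive must-link branching decisions with corresponding global index pairs $g(1),\dots,g(\ell)$, matrix $\mathcal{T}^\ell\in\{0,1\}^{(n-\ell)\times n}$ and vector $e^\ell\in\mathbb{R}^{n-\ell}$ (as defined in the context). Consider the shrunk semidefinite program $$\min\ -\langle \mathcal{T}^\ell W(\mathcal{T}^\ell)^\top, Z^\ell\rangle\quad\text{s.t.}\quad Z^\ell e^\ell=e_{n-\ell},\ \ \langle \mathcal{T}^\ell(\mathcal{T}^\ell)^\top,Z^\ell\rangle=k,\ \ Z^\ell\ge 0,\ \ Z^\ell\in\mathcal{S}^{n-\ell}_+,$$ and the semidefinite program $$\min\ -\langle W,Z\rangle\quad\text{s.t.}\quad Ze_n=e_n,\ \ \langle I,Z\rangle=k,\ \ Z_{i\cdot}=Z_{j\cdot}\ \ \forall \{i,j\}\in g(l),\ l\in\{1,\dots,\ell\},\ \ Z\ge 0,\ \ Z\in\mathcal{S}^n_+.$$ These two problems are equivalent: for every feasible solution of either problem there is a feasible solution of the other problem with the same objective function value.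
   Context: Notation: $\mathcal{S}^m_+$ is the set of real symmetric positive semidefinite $m\times m$ matrices; $\langle M,N\rangle=\mathrm{trace}(M^\top N)$; $Z\ge0$ is meant entrywise; $e_m$ is the all-ones vector of length $m$; $Z_{i\cdot}$ is row $i$ of $Z$. Branching decisions: let $0\le \ell<n$. For $r=1,\dots,\ell$ the decision at level $r$ is a pair $b(r)=(i,j)$ with $1\le i<j\le n-r+1$ (the indices refer to the rows of the problem of current size $n-r+1$). The $(n-r)\times(n-r+1)$ matrix $T^{b(r)}$ has rows $$T^{b(r)}_{s,\cdot}=\begin{cases}u_s^\top & \text{if } 1\le s<i \text{ or } i+1\le s<j,\\ u_i^\top+u_j^\top & \text{if } s=i,\\ u_{s+1}^\top & \text{if } j\le s\le n-r,\end{cases}$$ where $u_s$ is the $s$-th unit vector of length $n-r+1$. Thus left multiplication of a matrix $M$ by $T^{b(r)}$ replaces row $i$ of $M$ by the sum of rows $i$ and $j$, deletes row $j$, and leaves all other rows unchanged. Set $T^{b(0)}=I_n$, $\mathcal{T}^\ell=T^{b(\ell)}T^{b(\ell-1)}\cdots T^{b(1)}$ (with $\mathcal{T}^0=I_n$) and $e^\ell=\mathcal{T}^\ell e_n$. Global indices: each row of $\mathcal{T}^{r-1}$ is the 0/1 indicator vector of a group of original points in $\{1,\dots,n\}$ that have already been merged. If $b(r)=(i,j)$, then $g(r)=(\underline{i},\underline{j})$, where $\underline{i},\underline{j}\in\{1,\dots,n\}$ are original indices belonging to the groups of rows $i$ and $j$ of $\mathcal{T}^{r-1}$, respectively (for instance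 the smallest index in each group; the choice of representative does not affect the resulting collection of row-equality constraints). The notation ''$\{i,j\}\in g(l)$'' means that $i,j$ are the two global indices forming $g(l)$. *)

(* Defs.v *)
From HB Require Import structures.
From mathcomp Require Import all_boot all_order all_algebra.
From mathcomp Require Import reals.

Set Implicit Arguments.
Unset Strict Implicit.
Unset Printing Implicit Defensive.

Import Order.TTheory GRing.Theory Num.Theory.
Local Open Scope ring_scope.

Section Matrices.
Variable R : realType.

Definition mxdot m n (M N : 'M[R]_(m, n)) : R := \tr (M^T *m N).

Definition psdmx m (Z : 'M[R]_m) : Prop :=
  Z \is symmetricmx /\ forall x : 'cV[R]_m, 0 <= (x^T *m Z *m x) ord0 ord0.

Definition nonnegmx m n (Z : 'M[R]_(m, n)) : Prop := forall i j, 0 <= Z i j.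

Definition onesv m : 'cV[R]_m := const_mx 1.

End Matrices.

(* A minimization problem over the m x m matrices. *)
Record sdp (R : realType) (m : nat) := Sdp {
  objective : 'M[R]_m -> R;
  feasible : 'M[R]_m -> Prop }.

Definition equivalent_sdp (R : realType) (m n : nat)
    (P : sdp R m) (Q : sdp R n) : Prop :=
  (forall Y, feasible P Y ->
     exists2 Z, feasible Q Z & objective Q Z = objective P Y) /\
  (forall Z, feasible Q Z ->
     exists2 Y, feasible P Y & objective P Y = objective Q Z).

(* Levels r are numbered from 1, so only the values b 1, ..., b l of a sequence
   of branching decisions matter.  Row and column indices are numbered from 0
   as in 'I_n: the decision b r = (i, j) satisfies 0 <= i < j <= n - r, where
   n - r + 1 is the size of the problem at level r. *)
Definition branching_sequence (n l : nat) (b : nat -> nat * nat) : Prop :=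
  forall r, (1 <= r <= l)%N -> ((b r).1 < (b r).2 <= n - r)%N.

Section Branching.
Variable R : realType.

Definition unit_row m (s : nat) : 'rV[R]_m := \row_(t < m) (t == s :> nat)%:R.

(* For 1 <= r <= n, the number n - r.-1 of columns is n - r + 1. *)
Definition branch_mx (n r : nat) (ij : nat * nat) : 'M[R]_(n - r, n - r.-1) :=
  let: (i, j) := ij in
  \matrix_(s < n - r)
    if (s < i)%N || (i < s < j)%N then unit_row _ s
    else if s == i :> nat then unit_row _ i + unit_row _ j
    else unit_row _ s.+1.

Fixpoint merge_mx (n : nat) (b : nat -> nat * nat) (r : nat) :
    'M[R]_(n - r, n) :=
  match r with
  | 0 => castmx (esym (subn0 n), erefl n) 1%:M
  | r'.+1 => branch_mx n r'.+1 (b r'.+1) *m merge_mx n b r'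
  end.

(* The original points merged into row s after r decisions. *)
Definition group (n : nat) (b : nat -> nat * nat) (r s : nat) : {set 'I_n} :=
  [set t | [exists s' : 'I_(n - r),
              (s' == s :> nat) && (merge_mx n b r s' t == 1)]].

(* Any representatives of the two merged groups are allowed. *)
Definition global_indices (n l : nat) (b : nat -> nat * nat)
    (g : nat -> 'I_n * 'I_n) : Prop :=
  forall r, (1 <= r <= l)%N ->
    (g r).1 \in group n b r.-1 (b r).1 /\ (g r).2 \in group n b r.-1 (b r).2.

Definition shrunk_sdp (n : nat) (W : 'M[R]_n) (k l : nat)
    (b : nat -> nat * nat) : sdp R (n - l) :=
  let T := merge_mx n b l in
  {| objective := fun Z => - mxdot (T *m W *m T^T) Z;
     feasible := fun Z =>
       [/\ Z *m (T *m onesv R n) = onesv R (n - l),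
           mxdot (T *m T^T) Z = k%:R,
           nonnegmx Z
         & psdmx Z] |}.

Definition must_link_sdp (n : nat) (W : 'M[R]_n) (k l : nat)
    (g : nat -> 'I_n * 'I_n) : sdp R n :=
  {| objective := fun Z => - mxdot W Z;
     feasible := fun Z =>
       [/\ Z *m onesv R n = onesv R n,
           mxdot 1%:M Z = k%:R,
           forall r, (1 <= r <= l)%N -> row (g r).1 Z = row (g r).2 Z,
           nonnegmx Z
         & psdmx Z] |}.

End Branching.

(* Main.v *)
Require Import Defs.
From mathcomp Require Import all_boot all_order all_algebra.
From mathcomp Require Import reals.
From mathcomp Require Import zify.
Import GRing.Theory.
Local Open Scope ring_scope.

(** Every column of the merging matrix [T] is a unit vector: [T] is the
    incidence matrix of a surjection [f] sending each original point to the row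
    of the group that contains it.  Hence [T^T Y T] is the matrix with entries
    [Y (f i) (f j)] ([conj_colsub1]), which is the natural way to blow up a
    matrix on the groups to a matrix on the points; conversely, if [h] selects
    one point in each group, the entries [Z (h s) (h s')] form a matrix on the
    groups, and [T^T Y T] gives back [Z] as soon as the rows of the symmetric
    matrix [Z] agree inside each group ([mxsub_retract]).

    Objective and trace constraint agree for [Y] and [Z = T^T Y T] because
    [<T A T^T, Y> = <A, T^T Y T>] ([mxdot_adjoint]), used with [A = W] and
    [A = I].  Entrywise nonnegativity and positive semidefiniteness pass to
    [Y (f i) (f j)] for any map [f] ([psdmx_mxsub]), and the row sums are
    carried over because selecting rows commutes with multiplication on the
    right.

    It remains to see that the row equalities indexed by [g] describe the fibers
    of [f].  At each level the merge identifies exactly the labels [i] and [j],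
    one point of each of these two groups is listed in [g], and by induction all
    rows inside each of the two groups already agree; so one equality per level
    is enough ([merge_label_row]). *)

(** * Pulling matrices back along maps of indices *)

Section Pullback.
Variable R : realType.

Lemma symmetricmxP m (Z : 'M[R]_m) : reflect (Z^T = Z) (Z \is symmetricmx).
Proof.
by rewrite is_hermitianmxE expr0 scale1r map_mx_id //; apply: (iffP eqP).
Qed.

Lemma conj_colsub1 n m (f : 'I_n -> 'I_m) (Y : 'M[R]_m) :
  (colsub f 1%:M)^T *m Y *m colsub f 1%:M = mxsub f f Y.
Proof.
by rewrite trmx_mxsub trmx1 mul_rowsub_mx mul1mx mulmx_colsub mulmx1 -mxsubcr.
Qed.

Lemma mxdot_adjoint n m (T : 'M[R]_(m, n)) (A : 'M[R]_n) (Y : 'M[R]_m) :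
  mxdot (T *m A *m T^T) Y = mxdot A (T^T *m Y *m T).
Proof.
by rewrite /mxdot !trmx_mul trmxK -!mulmxA mxtrace_mulC !mulmxA.
Qed.

(** The map need not be injective: the pullback is the congruence of [Y] by the
    matrix [colsub f 1%:M], and congruences preserve semidefiniteness. *)
Lemma psdmx_mxsub n m (f : 'I_n -> 'I_m) (Y : 'M[R]_m) :
  psdmx Y -> psdmx (mxsub f f Y).
Proof.
case=> /symmetricmxP symY psdY; split.
  by apply/symmetricmxP; rewrite trmx_mxsub symY.
move=> x; rewrite -conj_colsub1.
by have := psdY (colsub f 1%:M *m x); rewrite trmx_mul !mulmxA.
Qed.

Lemma nonnegmx_mxsub n m (f : 'I_n -> 'I_m) (Y : 'M[R]_m) :
  nonnegmx Y -> nonnegmx (mxsub f f Y).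
Proof. by move=> Y0 i j; rewrite mxE. Qed.

(** By symmetry, equality of rows in a fiber of [f] gives equality of columns,
    so all entries may be moved to the representatives chosen by [h]. *)
Lemma mxsub_retract n m (f : 'I_n -> 'I_m) (h : 'I_m -> 'I_n) (Z : 'M[R]_n) :
    cancel h f -> Z^T = Z ->
    (forall t t', f t = f t' -> row t Z = row t' Z) ->
  mxsub f f (mxsub h h Z) = Z /\ colsub f (mxsub h h Z) = rowsub h Z.
Proof.
move=> hK symZ fibZ.
have fibE t t' u : f t = f t' -> Z t u = Z t' u.
  by move=> /fibZ /rowP /(_ u); rewrite !mxE.
have ZC t u : Z t u = Z u t by rewrite -{1}symZ mxE.
split; apply/matrixP => t u; rewrite !mxE.
  by rewrite (fibE _ t) ?hK // ZC (fibE _ u) ?hK // ZC.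
by rewrite ZC (fibE _ u) ?hK // ZC.
Qed.

End Pullback.

(** * Labels of the groups *)

(** The row of [branch_mx] receiving row [c], as [T^b] adds row [j] to row [i]
    and then closes the gap at [j]. *)
Definition merge_step (ij : nat * nat) (c : nat) : nat :=
  if c == ij.2 then ij.1 else unbump ij.2 c.

(** The recursion runs on natural numbers, so that labels at different levels,
    which are ordinals of different bounds, live in one type. *)
Fixpoint merge_label (b : nat -> nat * nat) (r : nat) (t : nat) : nat :=
  match r with
  | 0 => t
  | r'.+1 => merge_step (b r'.+1) (merge_label b r' t)
  end.

Lemma merge_step_bump ij s : merge_step ij (bump ij.2 s) = s.
Proof. by rewrite /merge_step eq_sym (negPf (neq_bump _ _)) bumpK. Qed.

Lemma merge_step_eq i j c c' : (i < j)%N ->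
  merge_step (i, j) c = merge_step (i, j) c' ->
  [\/ c = c', c = i /\ c' = j | c = j /\ c' = i].
Proof.
rewrite /merge_step /unbump /= => ltij.
have [->|cj] := eqVneq c j; have [->|c'j] := eqVneq c' j => e.
- exact: Or31.
- by apply: Or33; lia.
- by apply: Or32; lia.
- by apply: Or31; lia.
Qed.

Lemma merge_step_lt m ij c :
  (ij.1 < ij.2 <= m)%N -> (c < m.+1)%N -> (merge_step ij c < m)%N.
Proof. by rewrite /merge_step /unbump; case: eqP; lia. Qed.

Lemma branch_mxE (R : realType) n r ij (s : 'I_(n - r)) (c : 'I_(n - r.-1)) :
  (ij.1 < ij.2)%N -> branch_mx R n r ij s c = (merge_step ij c == s)%:R.
Proof.
case: ij => i j /= ltij; rewrite mxE /merge_step /unbump /=.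
case: ifPn => [s_id|s_move].
  by rewrite mxE; congr (nat_of_bool _)%:R; case: (eqVneq (c : nat) j); lia.
case: ifPn => [/eqP->|s_ne].
  rewrite !mxE; have [->|cj] := eqVneq (c : nat) j.
    by rewrite gtn_eqF // add0r eqxx.
  by rewrite addr0; congr (nat_of_bool _)%:R; lia.
by rewrite mxE; congr (nat_of_bool _)%:R; case: (eqVneq (c : nat) j); lia.
Qed.

Section Labels.
Context {n l : nat} {b : nat -> nat * nat}.
Hypotheses (hl : (l < n)%N) (hb : branching_sequence n l b).

Lemma merge_label_lt r t : (r <= l)%N -> (t < n)%N ->
  (merge_label b r t < n - r)%N.
Proof.
elim: r => [|r IHr] ltrl ltn /=; first by rewrite subn0.
apply: merge_step_lt; first exact: hb.
by rewrite -subSn ?subSS ?IHr //; lia.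
Qed.

Lemma merge_label_surj r s : (r <= l)%N -> (s < n - r)%N ->
  exists2 t, (t < n)%N & merge_label b r t = s.
Proof.
elim: r s => [|r IHr] s ltrl lts; first by exists s; rewrite // -[n]subn0.
(* [bump j s] is a row of the previous level sent to [s]. *)
have lt_bump : (bump (b r.+1).2 s < n - r)%N by move: lts; rewrite /bump; lia.
have [t ltn tE] := IHr _ (ltnW ltrl) lt_bump.
by exists t; rewrite //= tE merge_step_bump.
Qed.

Lemma merge_mxE (R : realType) r (s : 'I_(n - r)) (t : 'I_n) : (r <= l)%N ->
  merge_mx R n b r s t = (merge_label b r t == s)%:R.
Proof.
elim: r s => [|r IHr] s ltrl.
  by rewrite castmxE mxE /= -val_eqE /= eq_sym.
have lt_label : (merge_label b r t < n - r)%N.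
  by apply: merge_label_lt => //; lia.
have /andP[ltij _] := hb r.+1 ltrl.
rewrite [LHS]mxE (bigD1 (Ordinal lt_label)) //= big1 => [|c ne_c].
  rewrite addr0 [merge_mx _ _ _ _ _ _]IHr 1?ltnW // eqxx mulr1.
  by rewrite branch_mxE.
rewrite [merge_mx _ _ _ _ _ _]IHr 1?ltnW //.
by move: ne_c; rewrite -val_eqE eq_sym /= => /negPf ->; rewrite mulr0.
Qed.

Lemma mem_group (R : realType) r s (t : 'I_n) : (r <= l)%N ->
  t \in group R n b r s -> merge_label b r t = s.
Proof.
move=> lerl; rewrite inE => /existsP[s' /andP[/eqP <-]].
by rewrite merge_mxE //; case: (_ =P _ :> nat) => // _; rewrite eq_sym oner_eq0.
Qed.

Lemma merge_mx_incidence (R : realType) :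
  exists f : 'I_n -> 'I_(n - l), exists h : 'I_(n - l) -> 'I_n,
  [/\ merge_mx R n b l = colsub f 1%:M, cancel h f
    & forall t, f t = merge_label b l t :> nat].
Proof.
pose f (t : 'I_n) := Ordinal (merge_label_lt _ _ (leqnn l) (ltn_ord t)).
have [h hK] : exists h, forall s, f (h s) = s.
  apply: (fin_all_exists (P := fun s t => f t = s)) => s.
  have [t ltn tE] := merge_label_surj _ _ (leqnn l) (ltn_ord s).
  by exists (Ordinal ltn); apply: val_inj.
exists f, h; split=> //.
by apply/matrixP => s t; rewrite merge_mxE // !mxE -val_eqE eq_sym.
Qed.

Context {R : realType} {g : nat -> 'I_n * 'I_n}.
Hypothesis hg : global_indices R l b g.

Lemma merge_label_global r : (1 <= r <= l)%N ->
  merge_label b r (g r).1 = merge_label b r (g r).2.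
Proof.
case: r => // r ltrl; have [/mem_group g1 /mem_group g2] := hg r.+1 ltrl.
have /andP[ltij _] := hb r.+1 ltrl.
rewrite /= g1 1?ltnW // g2 1?ltnW // /merge_step eqxx ltn_eqF // /unbump.
by lia.
Qed.

Lemma merge_label_le r r' t t' : (r <= r')%N ->
  merge_label b r t = merge_label b r t' ->
  merge_label b r' t = merge_label b r' t'.
Proof.
by move=> /subnK <- e; elim: (r' - r)%N => //= m ->.
Qed.

(** When [i] and [j] are merged, the pair [g] links one point of each group, and
    the induction hypothesis links it to all other points of its group. *)
Lemma merge_label_row (Z : 'M[R]_n) :
    (forall r, (1 <= r <= l)%N -> row (g r).1 Z = row (g r).2 Z) ->
  forall r (t t' : 'I_n), (r <= l)%N ->
  merge_label b r t = merge_label b r t' -> row t Z = row t' Z.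
Proof.
move=> linkZ; elim=> [|r IHr] t t' ltrl /=.
  by move=> /val_inj ->.
have [/mem_group g1 /mem_group g2] := hg r.+1 ltrl.
have rowg := linkZ r.+1 ltrl; have lerl := ltnW ltrl.
have := hb r.+1 ltrl; move: (g1 lerl) (g2 lerl).
case: (b r.+1) => i j /= {}g1 {}g2 /andP[ltij _].
case/(merge_step_eq _ _ _ _ ltij) => [|[ti t'j]|[tj t'i]]; first exact: IHr.
  by rewrite (IHr t (g r.+1).1) ?g1 // rowg; apply: IHr; rewrite ?g2.
by rewrite (IHr t (g r.+1).2) ?g2 // -rowg; apply: IHr; rewrite ?g1.
Qed.

End Labels.

(** * Equivalence of the two programs *)

Theorem theorem3p2 (R : realType) (n d k l : nat)
    (p : 'I_n -> 'cV[R]_d) (W : 'M[R]_n)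
    (b : nat -> nat * nat) (g : nat -> 'I_n * 'I_n)
    (hW : forall i j, W i j = ((p i)^T *m p j) ord0 ord0)
    (hk : (0 < k)%N) (hl : (l < n)%N)
    (hb : branching_sequence n l b)
    (hg : global_indices R l b g) :
  equivalent_sdp (shrunk_sdp W k l b) (must_link_sdp W k l g).
Proof.
have [f [h [TE hK fE]]] := merge_mx_incidence hl hb R.
rewrite /equivalent_sdp /= TE; set T := colsub f 1%:M.
have dotW Y : mxdot (T *m W *m T^T) Y = mxdot W (mxsub f f Y).
  by rewrite mxdot_adjoint conj_colsub1.
have dot1 Y : mxdot (T *m T^T) Y = mxdot 1%:M (mxsub f f Y).
  by rewrite -conj_colsub1 -mxdot_adjoint mulmx1.
have mulT (Y : 'M[R]_(n - l)) : Y *m T = colsub f Y.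
  by rewrite mulmx_colsub mulmx1.
split=> [Y [Ye Yk Y0 psdY] | Z [Ze Zk linkZ Z0 psdZ]].
  exists (mxsub f f Y); last by rewrite dotW.
  split; [|by rewrite -dot1| |exact: nonnegmx_mxsub|exact: psdmx_mxsub].
    rewrite mxsubrc mul_rowsub_mx -mulT -mulmxA Ye.
    exact: mxsub_const.
  move=> r /andP[r1 rl]; apply/rowP => u; rewrite !mxE.
  have -> // : f (g r).1 = f (g r).2.
  apply: val_inj; rewrite /= !fE; apply: (merge_label_le r) => //.
  by apply: (merge_label_global hl hb hg); rewrite r1.
have /symmetricmxP symZ := psdZ.1.
have [ZE ZhE] : mxsub f f (mxsub h h Z) = Z
    /\ colsub f (mxsub h h Z) = rowsub h Z.
  apply: mxsub_retract => // t t' /(congr1 val); rewrite /= !fE.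
  exact: (merge_label_row hl hb hg).
exists (mxsub h h Z); last by rewrite dotW ZE.
split; [|by rewrite dot1 ZE|exact: nonnegmx_mxsub|exact: psdmx_mxsub].
by rewrite mulmxA mulT ZhE mul_rowsub_mx Ze; apply: mxsub_const.
Qed.
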